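(* For every list of dimensions $[N_0,\dots,N_{k-1}]$ of natural numbers and every payload set $D$, consider the $k$-dimensional torus network-on-chip (NoC) model described in the context. Assume output liveness: every core connected to the NoC handles arriving packets immediately. Then any message $m$ in the NoC at any input port $i$ of any router $r_{lcl}$ will eventually be delivered to its destination $m.dst$: for every state $s$ in which input port $i$ of $r_{lcl}$ holds $m$, there is an $n\in\mathbb N$ such that in the state $\mathrm{ns\_step}\ n\ s$ the message $m$ has been delivered to $m.dst$.
   Context: Routers $r_x$ are indexed by $x\in I=\prod_{j<k}\{0,\dots,N_j-1\}$, with coordinates in dimension $j$ taken modulo $N_j$ (wrap-around links). A packet (message) is a pair $m=(m.dst,m.data)\in I\times D$. Ports. For each router $r_x$, dimension $j<k$, direction in $\{\mathrm{Up},\mathrm{Down}\}$ and virtual class in $\{\mathrm{High},\mathrm{Low}\}$ there is a channel leaving $r_x$ and leading to router $r_{x+e_j}$ (Up) or $r_{x-e_j}$ (Down). Each router also has a channel leading into it from its core and a core output port leading to its core. Every channel stores at most one packet. The input ports of a router are the channels leading into it; its output ports are the channels leaving it towards neighbouring routers and its core output port. A channel is available iff it holds no packet. By output liveness, a core output port is always available. Routing (dimension order). For $a,b\in\{0,\dots,N-1\}$ let $\mathrm{dist}_N(a,b)=(b-a)\bmod N$. A packet at an input port of $r_x$ with destination $d$ is routed to the core output port of $r_x$ if $x=d$. Otherwise let $j$ be the least dimension with $x_j\neq d_j$; the packet is routed to the channel leaving $r_x$ in dimension $j$ with direction Up if $\mathrm{dist}_{N_j}(x_j,d_j)<\mathrm{dist}_{N_j}(d_j,x_j)$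 and Down otherwise; for Up the class is High if $d_j<x_j$ and Low otherwise; for Down the class is High if $x_j<d_j$ and Low otherwise. Arbitration (round robin). Each output port has an arbiter whose requests are the input ports of its router, numbered $0,\dots,c-1$ in a fixed way ($c$ the number of input ports), and a priority pointer $p\in\{0,\dots,c-1\}$. Among the input ports holding a packet routed to this output port, the arbiter selects the first one met when counting upwards cyclically modulo $c$ from $p$ (inclusive). States and steps. A state consists of the contents (a packet or nothing) of all channels and the priority pointers of all arbiters. In one cycle, simultaneously and based on the state at the beginning of the cycle, for each available output port for which the arbiter selects an input port, the selected packet is removed from that input port and placed in the output port (at a core output port it is handed to the core), and the priority pointer becomes the selected index plus one modulo $c$; everything else is unchanged. $\mathrm{ns\_step}\ n\ s$ is the state after executing the model for $n$ cycles starting from $s$. For a predicate $P$ on states, ''eventually $P$'' holds at $s$ iff $\exists n,\ P(\mathrm{ns\_step}\ n\ s)$. Delivery. A message $m$ is delivered to its destination once it has arrived at the router $r_{m.dst}$; in particular a message at an input port of $r_{lcl}$ with $lcl=m.dst$ counts as delivered.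
   Formalization: The state s is additionally assumed well routed: each packet on a channel between routers is on the channel to which the routing of the router it leaves sends it; for arbitrary channel contents the claim fails (three packets can deadlock on a ring of 3 routers). *)

(* Defs.v *)
From HB Require Import structures.
From mathcomp Require Import all_boot.

Set Implicit Arguments.
Unset Strict Implicit.
Unset Printing Implicit Defensive.

Variant direction := Up | Down.
Variant vclass := High | Low.

Definition bool_of_direction (d : direction) := if d is Up then true else false.
Definition direction_of_bool (b : bool) := if b then Up else Down.
Lemma bool_of_directionK : cancel bool_of_direction direction_of_bool.
Proof. by case. Qed.
HB.instance Definition _ := Equality.copy direction (can_type bool_of_directionK).

Definition bool_of_vclass (v : vclass) := if v is High then true else false.
Definition vclass_of_bool (b : bool) := if b then High else Low.
Lemma bool_of_vclassK : cancel bool_of_vclass vclass_of_bool.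
Proof. by case. Qed.
HB.instance Definition _ := Equality.copy vclass (can_type bool_of_vclassK).

(* For a, b < N, this is (b - a) mod N: N is added before the truncated
   subtraction. *)
Definition dist (N a b : nat) : nat := (b + N - a) %% N.

Section Topology.

Variable Ns : seq nat.

Notation k := (size Ns).

Definition node := {dffun forall j : 'I_k, 'I_(nth 0 Ns j)}.

Definition neighbour (x : node) (j : 'I_k) (dir : direction) : node :=
  [ffun i => if i == j then
               match dir with Up => ordS (x i) | Down => ord_pred (x i) end
             else x i].

(* A link is named by the router it leaves, so that parallel links (N_j = 2)
   and self-links (N_j = 1) stay distinct. *)
Definition link := (node * 'I_k * direction * vclass)%type.

Definition link_source (l : link) : node :=
  let: (x, _, _, _) := l in x.

Definition link_sink (l : link) : node :=
  let: (x, j, dir, _) := l in neighbour x j dir.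

(* The storage of the network.  Every channel is an input port of exactly one
   router, its sink. *)
Variant channel := ChLink of link | FromCore of node.

Definition sink (ch : channel) : node :=
  match ch with ChLink l => link_sink l | FromCore x => x end.

Variant outport := OutLink of link | ToCore of node.

Definition source (o : outport) : node :=
  match o with OutLink l => link_source l | ToCore x => x end.

Definition sum_of_channel (ch : channel) : link + node :=
  match ch with ChLink l => inl l | FromCore x => inr x end.
Definition channel_of_sum (u : link + node) : channel :=
  match u with inl l => ChLink l | inr x => FromCore x end.
Lemma sum_of_channelK : cancel sum_of_channel channel_of_sum.
Proof. by case. Qed.
HB.instance Definition _ := Equality.copy channel (can_type sum_of_channelK).

Definition sum_of_outport (o : outport) : link + node :=
  match o with OutLink l => inl l | ToCore x => inr x end.
Definition outport_of_sum (u : link + node) : outport :=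
  match u with inl l => OutLink l | inr x => ToCore x end.
Lemma sum_of_outportK : cancel sum_of_outport outport_of_sum.
Proof. by case. Qed.
HB.instance Definition _ := Equality.copy outport (can_type sum_of_outportK).

Definition up_shorter (x d : node) (j : 'I_k) : bool :=
  dist (nth 0 Ns j) (x j) (d j) < dist (nth 0 Ns j) (d j) (x j).

(* [enum 'I_k] is increasing, so j is the least dimension in which x and d
   differ. *)
Definition route (x d : node) : outport :=
  if x == d then ToCore x
  else if [seq j <- enum 'I_k | x j != d j] is j :: _ then
    if up_shorter x d j
    then OutLink (x, j, Up, if d j < x j then High else Low)
    else OutLink (x, j, Down, if x j < d j then High else Low)
  else ToCore x.

(* Two directions and two classes per dimension, and the core. *)
Definition ninputs : nat := (4 * k).+1.

Record numbering := Numbering {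
  request_line :> outport -> 'I_ninputs -> channel;
  request_line_inj : forall o, injective (request_line o);
  request_lineP : forall o ch,
    sink ch = source o <-> exists i, request_line o i = ch
}.

End Topology.

Arguments ninputs : simpl never.

Definition packet (Ns : seq nat) (D : Type) := (node Ns * D)%type.

Definition dst (Ns : seq nat) (D : Type) (m : packet Ns D) : node Ns := m.1.

Record state (Ns : seq nat) (D : Type) := State {
  content : channel Ns -> option (packet Ns D);
  priority : outport Ns -> 'I_(ninputs Ns)
}.

Section Dynamics.

Variables (Ns : seq nat) (D : Type) (num : numbering Ns).

Implicit Types (s : state Ns D) (m : packet Ns D).
Implicit Types (ch : channel Ns) (o : outport Ns).

(* Output liveness: a core output port is always available. *)
Definition available s o : bool :=
  match o with
  | OutLink l => ~~ isSome (content s (ChLink l))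
  | ToCore _ => true
  end.

Definition requests s o ch : bool :=
  if content s ch is Some m then route (sink ch) (dst m) == o else false.

(* [traject (@ordS c) p c] is p, p + 1, ..., p + c - 1 modulo c. *)
Definition arbiter s o : option 'I_(ninputs Ns) :=
  ohead [seq i <- traject (@ordS (ninputs Ns)) (priority s o) (ninputs Ns)
        | requests s o (num o i)].

Definition grant s o : option 'I_(ninputs Ns) :=
  if available s o then arbiter s o else None.

Definition incoming s ch : option (packet Ns D) :=
  if ch is ChLink l then
    if grant s (OutLink l) is Some i then content s (num (OutLink l) i)
    else None
  else None.

Definition granted s ch : bool :=
  if content s ch is Some m then
    let o := route (sink ch) (dst m) in
    if grant s o is Some i then num o i == ch else false
  else false.

(* The first two cases exclude each other: an incoming packet needs ch to be
   empty, a departing one needs it to be full. *)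
Definition step s : state Ns D := {|
  content := fun ch =>
    if incoming s ch is Some m then Some m
    else if granted s ch then None
    else content s ch;
  priority := fun o =>
    if grant s o is Some i then ordS i else priority s o
|}.

Definition ns_step (n : nat) s : state Ns D := iter n step s.

Definition eventually (P : state Ns D -> Prop) s : Prop :=
  exists n : nat, P (ns_step n s).

Definition delivered m s : Prop :=
  exists ch, sink ch = dst m /\ content s ch = Some m.

(* Every packet on a link was put there by the routing function of the router
   that the link leaves; core channels are unconstrained.  The empty network
   satisfies this, and injections by cores and [step] preserve it.  Packets on
   links chosen against the routing function can deadlock: for Ns = [:: 3],
   take packets on (1, Up, Low), (2, Up, High) and (0, Up, Low) with
   destinations 0, 1 and 2. *)
Definition well_routed s : Prop :=
  forall (l : link Ns) m,
    content s (ChLink l) = Some m -> route (link_source l) (dst m) = OutLink l.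

End Dynamics.

(* Main.v *)
(** Within one dimension and direction, a packet uses class High exactly as long
    as the wrap-around link is still ahead of it, so the Low links form a path
    and the High links a path leading into it.  As the dimensions are corrected
    in order, every link gets a rank that drops at each hop of a routed packet.
    By induction on the rank, a full channel is eventually emptied: the next
    link has smaller rank, so it becomes available again and again, and each
    grant to a competitor moves the round-robin pointer closer to the waiting
    input port.  Hence every packet keeps moving, and it can only make boundedly
    many hops. *)

Require Import Defs.
From mathcomp Require Import all_boot.
From mathcomp Require Import zify.

Set Implicit Arguments.
Unset Strict Implicit.
Unset Printing Implicit Defensive.

(** * Round robin *)

(** With [f] the cyclic successor and [t] the distance from the pointer to a requesting port, the
    winner lies no farther than that port, so the pointer never jumps past a waiting port. *)
Lemma ohead_filter_traject (T : Type) (f : T -> T) (q : pred T) n t x :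
  q (iter t f x) -> t < n ->
  exists2 u, u <= t & ohead [seq y <- traject f x n | q y] = Some (iter u f x).
Proof.
elim: n t x => [|n IHn] t x // qt lt_tn /=.
have [qx|nqx] := boolP (q x); first by exists 0.
case: t qt lt_tn => [|t]; first by rewrite /= (negPf nqx).
rewrite iterSr ltnS => qt lt_tn.
by have [u le_ut ->] := IHn t (f x) qt lt_tn; exists u.+1; rewrite // iterSr.
Qed.

Lemma ohead_filter (T : Type) (q : pred T) (s : seq T) x :
  ohead [seq y <- s | q y] = Some x -> q x.
Proof. by elim: s => //= y s IHs; case: ifP => // qy [<-]. Qed.

Lemma val_iter_ordS n t (p : 'I_n) : iter t (@ordS n) p = (p + t) %% n :> nat.
Proof.
elim: t => [|t IHt] /=; first by rewrite addn0 modn_small.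
by rewrite IHt addnS -[in LHS]addn1 modnDml addn1.
Qed.

Lemma iter_ordS_surj n (p i : 'I_n) :
  exists2 t, t < n & iter t (@ordS n) p = i.
Proof.
have n_gt0 : 0 < n by apply: leq_ltn_trans (ltn_ord i).
exists ((i + (n - p)) %% n); first by rewrite ltn_mod.
apply/val_inj; rewrite /= val_iter_ordS modnDmr addnCA subnKC ?modnDr ?modn_small //.
by rewrite ltnW.
Qed.

(** * Ranks of links *)

Lemma filter_enum_ord_min k (P : pred 'I_k) j r :
  [seq i <- enum 'I_k | P i] = j :: r -> P j /\ forall i, P i -> j <= i.
Proof.
move=> e.
have mem_jr i : (i \in j :: r) = P i by rewrite -e mem_filter mem_enum andbT.
split=> [|i Pi]; first by rewrite -mem_jr mem_head.
have : sorted (relpre val ltn) (j :: r).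
  rewrite -e; apply: sorted_filter; first by move=> ? ? ?; apply: ltn_trans.
  by rewrite -sorted_map val_enum_ord iota_ltn_sorted.
move/(order_path_min (fun _ _ _ => @ltn_trans _ _ _))/allP => lt_j.
by move: Pi; rewrite -mem_jr inE => /predU1P[-> //|/lt_j /ltnW].
Qed.

Definition hop_up N (a b : nat) : bool := dist N a b < dist N b a.

Definition hop_dir N (a b : nat) : direction :=
  if hop_up N a b then Up else Down.

Definition hop_class N (a b : nat) : vclass :=
  if (if hop_up N a b then b < a else a < b) then High else Low.

(** Counts the links that come later on the path going once around the ring in class High and then
    once in class Low. *)
Definition hop_rank N (a : nat) (dir : direction) (c : vclass) : nat :=
  (if c is High then N else 0) + (if dir is Up then N - a.+1 else a).

Definition hop_next N (dir : direction) (a : nat) : nat :=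
  if dir is Up then a.+1 %% N else (a + N).-1 %% N.

Lemma distE N a b : a < N -> b < N ->
  dist N a b = if a <= b then b - a else b + N - a.
Proof.
move=> aN bN; rewrite /dist; case: leqP => ab.
  by rewrite -addnBAC // modnDr modn_small //; lia.
by rewrite modn_small //; lia.
Qed.

(** The arc ahead shrinks and the other one grows, so the direction persists. An ordinary hop keeps
    the class and lowers the position term by one; the wrap-around hop turns High into Low, trading
    [N] for [N - 1]. *)
Lemma hop_rank_lt N a b a' : a < N -> b < N -> a != b ->
  a' = hop_next N (hop_dir N a b) a -> a' != b ->
  hop_dir N a' b = hop_dir N a b /\
  hop_rank N a' (hop_dir N a' b) (hop_class N a' b) <
  hop_rank N a (hop_dir N a b) (hop_class N a b).
Proof.
move=> aN bN ab a'E a'b.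
have {}a'E : a' = if hop_up N a b then if a.+1 == N then 0 else a.+1
                  else if a == 0 then N.-1 else a.-1.
  rewrite a'E /hop_next /hop_dir; case: hop_up.
    by case: eqP => [->|?]; rewrite ?modnn ?modn_small //; lia.
  case: eqP => [->|a0]; first by rewrite add0n modn_small //; lia.
  by rewrite (_ : (a + N).-1 = a.-1 + N) ?modnDr ?modn_small //; lia.
have a'N : a' < N by rewrite a'E; do !case: ifP => //; lia.
have upE : hop_up N a' b = hop_up N a b.
  by move: a'E; rewrite /hop_up !distE //; do !case: ifP => //; lia.
rewrite /hop_dir /hop_class upE; split=> //.
move: a'E; rewrite /hop_rank /hop_up !distE //.
by do !case: ifP => //=; lia.
Qed.

Lemma hop_rank_max N a dir c : a < N -> hop_rank N a dir c < N.*2.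
Proof. by rewrite /hop_rank; case: dir; case: c; lia. Qed.

Section Rank.

Variable Ns : seq nat.

Implicit Types (x d : node Ns) (l : link Ns) (j : 'I_(size Ns)).

Variant route_spec x d : outport Ns -> Prop :=
  | RouteCore of x = d : route_spec x d (ToCore x)
  | RouteLink j of x j != d j & (forall i, x i != d i -> j <= i) :
    route_spec x d (OutLink (x, j, hop_dir (nth 0 Ns j) (x j) (d j),
                             hop_class (nth 0 Ns j) (x j) (d j))).

Lemma routeP x d : route_spec x d (route x d).
Proof.
rewrite /route; case: eqP => [->|xd]; first exact: RouteCore.
case e: [seq j <- _ | _] => [|j r].
  case: xd; apply/ffunP => j; apply/eqP; apply: contraT => xj.
  by have := mem_filter (fun j => x j != d j) j (enum 'I_(size Ns));
    rewrite e mem_enum xj.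
have [xj minj] := filter_enum_ord_min e.
have := RouteLink xj minj.
by rewrite /hop_class /hop_dir /hop_up /up_shorter; case: ifP.
Qed.

(* Exceeds every [hop_rank], so that the dimension dominates in
   [channel_rank]. *)
Definition rank_base := (sumn Ns).*2.

Definition channel_rank (ch : channel Ns) : nat :=
  match ch with
  | ChLink (x, j, dir, c) =>
    (size Ns - j.+1) * rank_base + hop_rank (nth 0 Ns j) (x j) dir c
  | FromCore _ => size Ns * rank_base
  end.

(** Each dimension owns a block of [rank_base] consecutive ranks, with later dimensions in lower
    blocks. *)
Lemma channel_rank_dim x j dir c :
  channel_rank (ChLink (x, j, dir, c)) < (size Ns - j) * rank_base.
Proof.
rewrite /= (_ : size Ns - j = (size Ns - j.+1).+1); last first.
  by rewrite subnSK.
rewrite mulSn addnC ltn_add2r (leq_trans (hop_rank_max _ _ (ltn_ord _))) //.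
by rewrite leq_double sumnE (big_nth 0) big_mkord (bigD1 j) //= leq_addr.
Qed.

Lemma val_neighbour x j dir :
  neighbour x j dir j = hop_next (nth 0 Ns j) dir (x j) :> nat.
Proof. by rewrite ffunE eqxx; case: dir. Qed.

Lemma route_rank_lt x d l l' :
  route x d = OutLink l -> route (link_sink l) d = OutLink l' ->
  channel_rank (ChLink l') < channel_rank (ChLink l).
Proof.
case: routeP => // j xj minj [<-] /=; set dir := hop_dir _ _ _.
case: routeP => // j' yj' minj' [<-].
(* The hop alters only coordinate [j], so the dimensions before [j] remain corrected. *)
have le_jj' : j <= j'.
  have [->//|j'j] := eqVneq j' j.
  by apply: minj; move: yj'; rewrite ffunE (negPf j'j).
have [ej|lt_jj'] := eqVneq j j'; last first.
  apply: leq_trans (channel_rank_dim _ _ _ _) (leq_trans _ (leq_addr _ _)).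
  by rewrite leq_mul2r leq_sub2l ?orbT // ltn_neqAle lt_jj'.
rewrite -ej in yj' *; rewrite /= ltn_add2l.
by have [] := hop_rank_lt (ltn_ord _) (ltn_ord _) xj (val_neighbour x j dir) yj'.
Qed.

End Rank.

(** * Liveness *)

Section Liveness.

Variables (Ns : seq nat) (D : Type) (num : numbering Ns).

Implicit Types (s : state Ns D) (m : packet Ns D) (ch : channel Ns).

Lemma grant_requests s o i :
  grant num s o = Some i -> requests s o (num o i).
Proof. by rewrite /grant /arbiter; case: ifP => // _ ai; apply: ohead_filter ai. Qed.

Lemma sink_request_line o i : sink (num o i) = source o.
Proof. by case: (request_lineP num o (num o i)) => _; apply; exists i. Qed.

Lemma well_routed_step s : well_routed s -> well_routed (step num s).
Proof.
move=> wr l m /=; case g: (grant num s (OutLink l)) => [i|].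
  have := grant_requests g; rewrite /requests.
  case: (content s (num (OutLink l) i)) => // m' /eqP.
  by rewrite sink_request_line => rt [<-].
by case: ifP => // _ /wr.
Qed.

Lemma well_routed_ns_step n s : well_routed s -> well_routed (ns_step num n s).
Proof. by move=> wr; elim: n => //= n; apply: well_routed_step. Qed.

Lemma incoming_full s ch : content s ch -> incoming num s ch = None.
Proof.
by case: ch => //= l; rewrite /grant /available; case: (content s _).
Qed.

Lemma content_step_full s ch : content s ch ->
  content (step num s) ch = if granted num s ch then None else content s ch.
Proof. by move=> full /=; rewrite incoming_full. Qed.

Lemma content_step_granted s ch m l :
  content s ch = Some m -> granted num s ch ->
  route (sink ch) (dst m) = OutLink l ->
  content (step num s) (ChLink l) = Some m.
Proof.
move=> cm; rewrite /granted cm /= => + rt; rewrite rt.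
by case: grant => // i /eqP ->; rewrite cm.
Qed.

Definition eventually_granted s ch m : Prop :=
  eventually num (fun s => content s ch = Some m /\ granted num s ch) s.

Lemma eventually_step (P : state Ns D -> Prop) s :
  eventually num P (step num s) -> eventually num P s.
Proof. by case=> n Pn; exists n.+1; rewrite /ns_step iterSr. Qed.

(** Outer induction on the cyclic distance [t] from the pointer to the port, inner induction on the
    wait until the output is available. [live] ranges over all states because it is applied afresh
    after each lost arbitration. *)
Lemma eventually_grantedP ch m :
  let o := route (sink ch) (dst m) in
  (forall s, well_routed s -> content s ch = Some m ->
     eventually num (fun s => available s o) s) ->
  forall s, well_routed s -> content s ch = Some m ->
  eventually_granted s ch m.
Proof.
move=> o live s wr cm.
have [i chE] : exists i, num o i = ch.
  case: (request_lineP num o ch) => + _; apply.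
  by rewrite /o; case: routeP.
have [t] := iter_ordS_surj (priority s o) i.
elim/ltn_ind: t s wr cm => t IHt s wr cm lt_t pt.
have granted_if_available s1 : well_routed s1 -> content s1 ch = Some m ->
    iter t (@ordS _) (priority s1 o) = i -> available s1 o ->
    eventually_granted s1 ch m.
  move=> wr1 cm1 pt1 av1.
  have req : requests s1 o (num o (iter t (@ordS _) (priority s1 o))).
    by rewrite pt1 chE /requests cm1.
  have [u le_ut garb] := ohead_filter_traject
    (q := fun i => requests s1 o (num o i)) req lt_t.
  have gE : grant num s1 o = Some (iter u (@ordS _) (priority s1 o)).
    by rewrite /grant av1.
  have [eu|ne_ut] := eqVneq u t.
    by exists 0; split=> //; rewrite /granted cm1 /= -/o gE eu pt1 chE.
  case gch: (granted num s1 ch); first by exists 0.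
  (* A competitor at distance [u < t] won, and the pointer now stands just past it. *)
  apply: eventually_step; apply: (IHt (t - u.+1)).
  - lia.
  - exact: well_routed_step.
  - by rewrite content_step_full ?cm1 // gch.
  - lia.
  by rewrite /= gE -[ordS _]iterS -iterD subnK // ltn_neqAle ne_ut.
have [n] := live s wr cm.
(* An early availability is used at once, since a grant would move the pointer; otherwise packet and
   pointer stay put and the wait shortens. *)
elim: n s wr cm pt => [|n IHn] s wr cm pt; first exact: granted_if_available.
rewrite /ns_step iterSr => av.
have [av0|nav0] := boolP (available s o); first exact: granted_if_available.
have g0 : grant num s o = None by rewrite /grant (negPf nav0).
have gch : granted num s ch = false by rewrite /granted cm -/o g0.
apply: eventually_step; apply: IHn => //.
- exact: well_routed_step.
- by rewrite content_step_full ?cm // gch.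
by rewrite /= g0.
Qed.

(** [well_routed] makes an occupied link the routing choice at its source, so two consecutive
    choices are compared; a core channel ranks above all links. *)
Lemma channel_rank_lt s ch m l :
  well_routed s -> content s ch = Some m ->
  route (sink ch) (dst m) = OutLink l ->
  channel_rank (ChLink l) < channel_rank ch.
Proof.
case: ch => [l0|x] wr cm; first by apply: route_rank_lt; apply: wr.
case: routeP => // j _ _ [<-].
by rewrite (leq_trans (channel_rank_dim _ _ _ _)) // leq_mul2r leq_subr orbT.
Qed.

Lemma progress s ch m :
  well_routed s -> content s ch = Some m -> eventually_granted s ch m.
Proof.
have [r] := ubnP (channel_rank ch).
elim: r ch m s => // r IHr ch m s lt_r; apply: eventually_grantedP => {}s wr cm.
case rt: (route (sink ch) (dst m)) => [l|x]; last by exists 0.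
case cl: (content s (ChLink l)) => [m'|]; last by exists 0; rewrite /= cl.
have lt_l := leq_trans (channel_rank_lt wr cm rt) lt_r.
(* The occupant of the next link is granted after [n] steps. A full link accepts nothing in that
   cycle, so it is empty at [n.+1]. *)
have [n [cln gln]] := IHr (ChLink l) m' s lt_l wr cl.
by exists n.+1; rewrite /ns_step iterS /available content_step_full ?gln ?cln.
Qed.

End Liveness.

Theorem theorem7 (Ns : seq nat) (D : Type) (num : numbering Ns)
    (s : state Ns D) (hs : well_routed s)
    (lcl : node Ns) (i : channel Ns) (hi : sink i = lcl)
    (m : packet Ns D) (hm : content s i = Some m) :
  eventually num (delivered m) s.
Proof.
have [r] := ubnP (channel_rank i).
elim: r i s hs hm {hi lcl} => // r IHr i s hs hm lt_r.
have [n [cn gn]] := progress num hs hm.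
have wrn : well_routed (ns_step num n s) by apply: well_routed_ns_step.
case rt: (route (sink i) (dst m)) => [l|x].
  have lt_l := leq_trans (channel_rank_lt wrn cn rt) lt_r.
  have [n' dn'] := IHr _ _ (well_routed_step wrn)
    (content_step_granted cn gn rt) lt_l.
  by exists (n' + n.+1); rewrite /ns_step iterD.
(* Only at the destination does [route] name a core port, so [m] is already delivered in [s]. *)
exists 0, i; split=> //.
by case: routeP rt.
Qed.
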